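(* Let $n,p,K$ be positive integers, let $\boldsymbol{x}_i=(x_{ij})_{j\in[p]}\in\mathbb{R}^p$ and $y_i\in\{-1,+1\}$ for $i\in[n]$, let $\gamma\in\mathbb{R}_+$, and let $\mathcal{N}_1,\dots,\mathcal{N}_K$ be a partition of $[n]$ into folds, with training sets $\mathcal{T}_k:=[n]\setminus\mathcal{N}_k$. For each $k\in[K]$, suppose that $\boldsymbol{w}^{(k)}\in\mathbb{R}^p$, $b^{(k)}\in\mathbb{R}$ and $\boldsymbol{z}\in\{0,1\}^p$ satisfy the constraint $$z_j=0\Rightarrow w_j^{(k)}=0\quad(j\in[p]).$$ Then $(\boldsymbol{w}^{(k)},b^{(k)})\in\mathcal{A}^{(k)}(\boldsymbol{z})$ if and only if both of the following hold: $$w_j^{(k)}-\gamma\sum_{i\in\mathcal{T}_k}\left(y_i-(\boldsymbol{w}^{(k)})^\top\boldsymbol{x}_i-b^{(k)}\right)x_{ij}=0\quad\text{for each } j\in[p]\text{ with } z_j=1,$$ and $$\gamma\sum_{i\in\mathcal{T}_k}\left(y_i-(\boldsymbol{w}^{(k)})^\top\boldsymbol{x}_i-b^{(k)}\right)=0.$$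
   Context: For a positive integer $m$, $[m]:=\{1,\dots,m\}$; $\mathbb{R}_+$ is the set of nonnegative real numbers. The samples are $(\boldsymbol{x}_i,y_i)$, $i\in[n]$, with feature vectors $\boldsymbol{x}_i\in\mathbb{R}^p$ and class labels $y_i\in\{-1,+1\}$. The folds $\mathcal{N}_k$ ($k\in[K]$) satisfy $[n]=\bigcup_{k\in[K]}\mathcal{N}_k$ and $\mathcal{N}_k\cap\mathcal{N}_{k'}=\emptyset$ for $k\neq k'$, and are of approximately equal size ($|\mathcal{N}_k|\approx n/K$). The training set of fold $k$ is $\mathcal{T}_k:=[n]\setminus\mathcal{N}_k$. The parameter $\gamma$ weights the loss term. For $k\in[K]$ and $\boldsymbol{z}=(z_j)_{j\in[p]}\in\{0,1\}^p$ (feature $j$ is selected when $z_j=1$), $\mathcal{A}^{(k)}(\boldsymbol{z})$ denotes the set of optimal solutions (global minimizers) $(\boldsymbol{w}^{(k)},b^{(k)})\in\mathbb{R}^p\times\mathbb{R}$ of the least squares SVM training problem $$\min\quad \frac{1}{2}\|\boldsymbol{w}^{(k)}\|_2^2+\frac{\gamma}{2}\sum_{i\in\mathcal{T}_k}\left(1-y_i\left((\boldsymbol{w}^{(k)})^\top\boldsymbol{x}_i+b^{(k)}\right)\right)^2$$ $$\textrm{s.t.}\quad z_j=0\Rightarrow w_j^{(k)}=0\quad(j\in[p]),$$ where $\boldsymbol{z}$ is fixed, $w_j^{(k)}$ is the $j$-th component of $\boldsymbol{w}^{(k)}$, and $\|\cdot\|_2$ is the Euclidean norm. *)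

(* Defs.v *)
From mathcomp Require Import all_boot all_order all_algebra.
From mathcomp Require Import classical_sets reals.

Set Implicit Arguments.
Unset Strict Implicit.
Unset Printing Implicit Defensive.

Import Order.TTheory GRing.Theory Num.Theory.
Local Open Scope ring_scope.

(* The Euclidean norm: the library norm `|w| on matrices is the sup norm. *)
Definition norm2 (R : realType) (p : nat) (w : 'cV[R]_p) : R :=
  Num.sqrt (\sum_(j < p) w j 0 ^+ 2).

Definition dotv (R : realType) (p : nat) (w x : 'cV[R]_p) : R :=
  (w^T *m x) 0 0.

Definition training_set (n K : nat) (N : 'I_K -> {set 'I_n}) (k : 'I_K) :
    {set 'I_n} :=
  (~: N k)%SET.

(* A vector z in {0,1}^p is encoded as a boolean function: z j = true when
   z_j = 1 and z j = false when z_j = 0. *)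
Definition supported (R : realType) (p : nat) (z : {ffun 'I_p -> bool})
    (w : 'cV[R]_p) : Prop :=
  forall j : 'I_p, z j = false -> w j 0 = 0.

Definition lssvm_objective (R : realType) (n p : nat) (x : 'I_n -> 'cV[R]_p)
    (y : 'I_n -> R) (gamma : R) (T : {set 'I_n}) (w : 'cV[R]_p) (b : R) : R :=
  1 / 2 * norm2 w ^+ 2
  + gamma / 2 * \sum_(i in T) (1 - y i * (dotv w (x i) + b)) ^+ 2.

Definition lssvm_solutions (R : realType) (n p K : nat)
    (x : 'I_n -> 'cV[R]_p) (y : 'I_n -> R) (gamma : R)
    (N : 'I_K -> {set 'I_n}) (k : 'I_K) (z : {ffun 'I_p -> bool}) :
    set ('cV[R]_p * R) :=
  [set wb | supported z wb.1 /\
    forall (w' : 'cV[R]_p) (b' : R), supported z w' ->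
      lssvm_objective x y gamma (training_set N k) wb.1 wb.2
      <= lssvm_objective x y gamma (training_set N k) w' b']%classic.

(* Main.v *)
(** The objective is a convex quadratic: since [y i ^+ 2 = 1], a step [(d, c)]
    from [(w, b)] changes it by a linear form plus a nonnegative quadratic form
    in [(d, c)].  If the linear form vanishes on the supported directions, then
    [(w, b)] is a global minimizer; conversely, along a supported
    direction [t * a + t ^+ 2 * q >= 0] for all [t] forces [a = 0]. *)
Require Import Defs.
From mathcomp Require Import all_boot all_order all_algebra.
From mathcomp Require Import reals.
From mathcomp Require Import ring lra.

Import Order.TTheory GRing.Theory Num.Theory.
Local Open Scope ring_scope.

Lemma linear_coef_eq0 (R : realFieldType) (a q : R) :
  0 <= q -> (forall t, 0 <= t * a + t ^+ 2 * q) -> a = 0.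
Proof.
move=> q_ge0 nonneg; have q1_gt0 : 0 < q + 1 by lra.
(* The exact minimizer would be [- a / (2 * q)]; the denominator [q + 1] also covers [q = 0] and
   still makes the value minus a square. *)
have := nonneg (- a / (q + 1)).
have -> : - a / (q + 1) * a + (- a / (q + 1)) ^+ 2 * q = - (a / (q + 1)) ^+ 2.
  by field; rewrite gt_eqF.
rewrite oppr_ge0 => sq_le0.
have /eqP : (a / (q + 1)) ^+ 2 = 0 by apply/le_anti; rewrite sq_le0 sqr_ge0.
by rewrite sqrf_eq0 mulf_eq0 invr_eq0 (gt_eqF q1_gt0) orbF => /eqP.
Qed.

Lemma norm2_sqr (R : realType) (p : nat) (w : 'cV[R]_p) :
  norm2 w ^+ 2 = \sum_(j < p) w j 0 ^+ 2.
Proof. by rewrite sqr_sqrtr // sumr_ge0 // => j _; rewrite sqr_ge0. Qed.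

Lemma dotvE (R : realType) (p : nat) (w x : 'cV[R]_p) :
  dotv w x = \sum_(j < p) w j 0 * x j 0.
Proof. by rewrite /dotv mxE; apply: eq_bigr => j _; rewrite mxE. Qed.

Lemma dotvDl (R : realType) (p : nat) (v w x : 'cV[R]_p) :
  dotv (v + w) x = dotv v x + dotv w x.
Proof. by rewrite /dotv linearD mulmxDl mxE. Qed.

Lemma dotvZl (R : realType) (p : nat) (a : R) (w x : 'cV[R]_p) :
  dotv (a *: w) x = a * dotv w x.
Proof. by rewrite /dotv linearZ -scalemxAl mxE. Qed.

Lemma sum_mul_delta (R : nzRingType) (p : nat) (j : 'I_p) (f : 'I_p -> R) :
  \sum_(l < p) (delta_mx j 0 : 'cV[R]_p) l 0 * f l = f j.
Proof.
rewrite (bigD1 j) //= mxE !eqxx mul1r big1 ?addr0 // => l /negPf l_neq_j.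
by rewrite mxE l_neq_j mul0r.
Qed.

Section Objective.
Variables (R : realType) (n p : nat).
Variables (x : 'I_n -> 'cV[R]_p) (y : 'I_n -> R) (gamma : R) (T : {set 'I_n}).
Hypothesis y_label : forall i, y i = -1 \/ y i = 1.
Hypothesis gamma_ge0 : 0 <= gamma.

Let residual w b i := y i - dotv w (x i) - b.

Definition lssvm_grad_w (w : 'cV[R]_p) (b : R) (j : 'I_p) : R :=
  w j 0 - gamma * \sum_(i in T) residual w b i * x i j 0.

Definition lssvm_grad_b (w : 'cV[R]_p) (b : R) : R :=
  - (gamma * \sum_(i in T) residual w b i).

(** Half the Hessian quadratic form at [(d, c)], i.e. the full second-order term of the expansion;
    it does not depend on the base point. *)
Definition lssvm_hess (d : 'cV[R]_p) (c : R) : R :=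
  1 / 2 * (\sum_(j < p) d j 0 ^+ 2)
  + gamma / 2 * \sum_(i in T) (dotv d (x i) + c) ^+ 2.

Lemma lssvm_hess_ge0 d c : 0 <= lssvm_hess d c.
Proof.
by rewrite addr_ge0 // mulr_ge0 ?divr_ge0 // sumr_ge0 // => i _; rewrite sqr_ge0.
Qed.

Lemma lssvm_hessZ t d c : lssvm_hess (t *: d) (t * c) = t ^+ 2 * lssvm_hess d c.
Proof.
rewrite /lssvm_hess.
under eq_bigr do rewrite mxE exprMn.
under [X in _ + _ * X]eq_bigr do rewrite dotvZl -mulrDr exprMn.
by rewrite -!mulr_sumr; ring.
Qed.

(** For a label [y i] equal to 1 or -1, [1 - y i * m = y i * (y i - m)], and squaring removes the
    sign. *)
Lemma lssvm_objectiveE w b :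
  lssvm_objective x y gamma T w b =
  1 / 2 * (\sum_(j < p) w j 0 ^+ 2)
  + gamma / 2 * \sum_(i in T) residual w b i ^+ 2.
Proof.
rewrite /lssvm_objective norm2_sqr; congr (_ + _ * _); apply: eq_bigr => i _.
by rewrite /residual; case: (y_label i) => ->; ring.
Qed.

(** Second-order Taylor expansion, exact because the objective is quadratic. The norm and the loss
    are expanded separately. *)
Lemma lssvm_objectiveD w b d c :
  lssvm_objective x y gamma T (w + d) (b + c) =
  lssvm_objective x y gamma T w b
  + (\sum_(j < p) d j 0 * lssvm_grad_w w b j + c * lssvm_grad_b w b)
  + lssvm_hess d c.
Proof.
have normD : \sum_(j < p) (w + d) j 0 ^+ 2 =
    \sum_(j < p) w j 0 ^+ 2 + 2 * (\sum_(j < p) d j 0 * w j 0)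
    + \sum_(j < p) d j 0 ^+ 2.
  rewrite mulr_sumr -!big_split; apply: eq_bigr => j _ /=.
  by rewrite mxE; ring.
(* The step lowers each residual by [dotv d (x i) + c]. *)
have lossD : \sum_(i in T) residual (w + d) (b + c) i ^+ 2 =
    \sum_(i in T) residual w b i ^+ 2
    - 2 * (\sum_(i in T) residual w b i * dotv d (x i)
           + c * \sum_(i in T) residual w b i)
    + \sum_(i in T) (dotv d (x i) + c) ^+ 2.
  rewrite mulr_sumr -big_split mulr_sumr -sumrN -!big_split.
  by apply: eq_bigr => i _ /=; rewrite /residual dotvDl; ring.
(* Exchanging the sums over features and samples reassembles the inner products [dotv d (x i)]. *)
have gradE : \sum_(j < p) d j 0 * lssvm_grad_w w b j =
    \sum_(j < p) d j 0 * w j 0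
    - gamma * \sum_(i in T) residual w b i * dotv d (x i).
  under eq_bigr do rewrite mulrBr mulrCA.
  rewrite sumrB -mulr_sumr; congr (_ - _ * _).
  under eq_bigr do rewrite mulr_sumr.
  rewrite exchange_big; apply: eq_bigr => i _.
  by rewrite dotvE mulr_sumr; apply: eq_bigr => j _; rewrite mulrCA.
rewrite !lssvm_objectiveE normD lossD gradE /lssvm_grad_b /lssvm_hess.
by field.
Qed.

(** The whole line through [(w, b)] in direction [(d, c)] is feasible, so minimality makes
    [t * a + t ^+ 2 * q] nonnegative for every [t], with [a] the directional derivative. *)
Lemma lssvm_stationary (z : {ffun 'I_p -> bool}) w b d c :
  supported z w -> supported z d ->
  (forall w' b', supported z w' ->
     lssvm_objective x y gamma T w b <= lssvm_objective x y gamma T w' b') ->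
  \sum_(j < p) d j 0 * lssvm_grad_w w b j + c * lssvm_grad_b w b = 0.
Proof.
move=> w_supp d_supp w_min.
apply: (linear_coef_eq0 _ _ _ (lssvm_hess_ge0 d c)) => t.
have wd_supp : supported z (w + t *: d).
  by move=> j zj; rewrite !mxE w_supp // d_supp // mulr0 addr0.
have := w_min _ (b + t * c) wd_supp.
rewrite lssvm_objectiveD lssvm_hessZ -addrA lerDl.
suff -> : \sum_(j < p) (t *: d) j 0 * lssvm_grad_w w b j =
          t * \sum_(j < p) d j 0 * lssvm_grad_w w b j by rewrite -mulrA -mulrDr.
by rewrite mulr_sumr; apply: eq_bigr => j _; rewrite mxE mulrA.
Qed.

End Objective.

Theorem theorem2 (R : realType) (n p K : nat)
    (n_gt0 : (0 < n)%N) (p_gt0 : (0 < p)%N) (K_gt0 : (0 < K)%N)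
    (x : 'I_n -> 'cV[R]_p) (y : 'I_n -> R)
    (y_label : forall i : 'I_n, y i = -1 \/ y i = 1)
    (gamma : R) (gamma_ge0 : 0 <= gamma)
    (N : 'I_K -> {set 'I_n})
    (N_cover : \bigcup_(k < K) N k = [set: 'I_n])
    (N_disjoint : forall k k' : 'I_K, k != k' -> [disjoint N k & N k'])
    (k : 'I_K) (w : 'cV[R]_p) (b : R) (z : {ffun 'I_p -> bool})
    (w_supp : supported z w) :
  lssvm_solutions x y gamma N k z (w, b) <->
  (forall j : 'I_p, z j = true ->
     w j 0 - gamma * (\sum_(i in training_set N k)
                        (y i - dotv w (x i) - b) * x i j 0) = 0) /\
  gamma * (\sum_(i in training_set N k) (y i - dotv w (x i) - b)) = 0.
Proof.
split=> [[_ /= w_min] | [grad_w0 grad_b0]].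
  have stationary d c (d_supp : supported z d) :=
    lssvm_stationary _ _ _ _ _ _ _ y_label gamma_ge0 z w b d c
      w_supp d_supp w_min.
  split=> [j zj|].
    (* The direction [(delta_mx j 0, 0)], admissible since [z j = true], isolates the derivative in
       [w j 0]. *)
    have delta_supp : supported z (delta_mx j 0 : 'cV[R]_p).
      by move=> l; rewrite mxE; case: eqP => // ->; rewrite zj.
    by have := stationary _ 0 delta_supp; rewrite sum_mul_delta mul0r addr0.
  (* The direction [(0, 1)] isolates the derivative in [b]. *)
  have supp0 : supported z (0 : 'cV[R]_p) by move=> j _; rewrite mxE.
  have := stationary _ 1 supp0; rewrite big1 => [|j _]; last by rewrite mxE mul0r.
  by rewrite add0r mul1r => /eqP; rewrite oppr_eq0 => /eqP.
split=> //= w' b' w'_supp.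
(* Expand at [(w, b)] with the step [(w' - w, b' - b)]; it remains to show that the linear term
   vanishes. *)
rewrite -[w'](subrKC w) -[b'](subrKC b) lssvm_objectiveD // -addrA lerDl.
rewrite /lssvm_grad_b grad_b0 oppr0 mulr0 addr0 big1 ?add0r ?lssvm_hess_ge0 //.
(* On selected features the gradient is zero; on the others [w] and [w'] both vanish, so the step
   does too. *)
move=> j _; case zj : (z j); first by rewrite /lssvm_grad_w grad_w0 ?mulr0.
by rewrite !mxE w_supp // w'_supp // subrr mul0r.
Qed.
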